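(* Let $0<a\le b\le2$, let $t\mapsto H_t\in[a,b]$ be a continuous function on $\mathbf{R}$, let $\lambda>0$, and let $X_{H_t,\alpha,\lambda}(t)$ be the linear tempered multifractional stable motion. Assume $\alpha\in(0,1]$ and $t_0>0$. Then there is a positive number $c$, depending only on $a,b,\lambda,t_0$ and $\alpha$, such that $$\Big\|X_{H_t,\alpha,\lambda}(t)-X_{H_s,\alpha,\lambda}(s)\Big\|_\alpha\ge c\Big(|t-s|^{H_t}+|H_t-H_s|\Big)$$ for all $t,s$ satisfying $t_0\le s\le t\le s+1$.
   Context: Conventions: $(x)_+=\max\{x,0\}$ and $0^\gamma=0$ for all $\gamma\in\mathbf{R}$. The linear tempered multifractional stable motion (LTmFSM) is $$X_{H_t,\alpha,\lambda}(t)=\int_{-\infty}^\infty G_{H_t,\alpha,\lambda}(t,x)\,dZ_\alpha(x),\quad G_{H_t,\alpha,\lambda}(t,x)=e^{-\lambda(t-x)_+}(t-x)_+^{H_t-\frac1\alpha}-e^{-\lambda(-x)_+}(-x)_+^{H_t-\frac1\alpha},$$ where $dZ_\alpha$ is an independently scattered symmetric $\alpha$-stable random measure on $\mathbf{R}$ with control measure $dx$, normalized so that $\mathbf{E}[e^{i\int f\,dZ_\alpha}]=\exp\{-\int|f|^\alpha dx\}$. For $f\in L^\alpha(\mathbf{R})$ the quasi norm of $\int f\,dZ_\alpha$ is $\|\int f\,dZ_\alpha\|_\alpha=\big(\int_{-\infty}^\infty|f(x)|^\alpha dx\big)^{1/\alpha}$; thus $$\Big\|X_{H_t,\alpha,\lambda}(t)-X_{H_s,\alpha,\lambda}(s)\Big\|_\alpha=\Big(\int_{-\infty}^\infty\big|G_{H_t,\alpha,\lambda}(t,x)-G_{H_s,\alpha,\lambda}(s,x)\big|^\alpha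 dx\Big)^{1/\alpha}.$$ *)

(* Defs.v *)
From HB Require Import structures.
From mathcomp Require Import all_boot all_order all_algebra.
From mathcomp Require Import all_classical all_reals all_analysis.
Import Order.TTheory GRing.Theory Num.Theory.
Import numFieldNormedType.Exports.

Set Implicit Arguments.
Unset Strict Implicit.
Unset Printing Implicit Defensive.

Local Open Scope classical_set_scope.
Local Open Scope ring_scope.

(* (x)_+ ^ g with the convention 0 ^ g = 0 for every real g; the library's
   powR has 0 `^ 0 = 1 instead, hence the case distinction. *)
Definition pos_part_pow (R : realType) (x g : R) : R :=
  if 0 < x then x `^ g else 0.

Definition ltm_kernel (R : realType) (h alpha lambda t x : R) : R :=
  expR (- lambda * Num.max (t - x) 0) * pos_part_pow (t - x) (h - alpha^-1)
  - expR (- lambda * Num.max (- x) 0) * pos_part_pow (- x) (h - alpha^-1).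

(* For p < 1 the library's Lnorm is only a quasi norm, and its Lfun is the set
   of measurable f with \int |f|^p < +oo. *)
Definition Lalpha (R : realType) (alpha : R) (f : R -> R) : Prop :=
  f \in Lfun (@lebesgue_measure R) alpha%:E.

(* [stable_integral alpha I]: I f is \int f dZ for an independently scattered
   symmetric alpha-stable random measure Z with Lebesgue control measure, where
   Z A = I \1_A for Borel sets A of finite measure.  I is a total function, but
   it is constrained only on L^alpha.  The real and imaginary parts of
   E[exp(i \int f dZ)] = exp(- \int |f|^alpha dx) are stated separately; with
   linearity they determine the joint law of the integrals. *)
Record stable_integral (R : realType) (d : measure_display)
    (T : measurableType d) (P : probability T R) (alpha : R)
    (I : (R -> R) -> {RV P >-> R}) : Prop := StableIntegral {
  stable_integral_scattered :
    forall (n : nat) (A B : 'I_n -> set R),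
      (forall i, measurable (A i)) -> (forall i, measurable (B i)) ->
      (forall i, (lebesgue_measure (A i) < +oo)%E) ->
      trivIset [set: 'I_n] A ->
      P (\bigcap_i (I (\1_(A i)) @^-1` B i)) =
      (\prod_(i < n) P (I (\1_(A i)) @^-1` B i))%E ;
  stable_integral_sigma_additive :
    forall A : nat -> set R,
      (forall k, measurable (A k)) -> trivIset [set: nat] A ->
      (lebesgue_measure (\bigcup_k A k) < +oo)%E ->
      {ae P, forall w, (\sum_(0 <= k < n) I (\1_(A k)) w) @[n --> \oo] -->
                       (I (\1_(\bigcup_k A k)) w : R)} ;
  stable_integral_cos :
    forall f, Lalpha alpha f ->
      ('E_P[fun w => cos (I f w)] =
       (expR (- Rintegral lebesgue_measure setT (fun x => `|f x| `^ alpha)))%R%:E)%E ;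
  stable_integral_sin :
    forall f, Lalpha alpha f -> ('E_P[fun w => sin (I f w)] = 0)%E ;
  stable_integral_linear :
    forall (k l : R) f g, Lalpha alpha f -> Lalpha alpha g ->
      {ae P, forall w, I (fun x => k * f x + l * g x) w =
                       k * I f w + l * I g w}
}.

(* X is the linear tempered multifractional stable motion driven by Z; each
   X_{H_t}(t) is only determined up to a null event. *)
Definition is_LTmFSM (R : realType) (d : measure_display)
    (T : measurableType d) (P : probability T R)
    (I : (R -> R) -> {RV P >-> R}) (H : R -> R) (alpha lambda : R)
    (X : R -> {RV P >-> R}) : Prop :=
  forall t : R,
    {ae P, forall w, X t w = I (ltm_kernel (H t) alpha lambda t) w}.

(* The quasi norm || \int f dZ ||_alpha = (\int |f|^alpha dx)^(1/alpha), as a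
   function of the random variable Y = \int f dZ: all integrands f of Y give the
   same value, by [stable_integral_cos].  It has the irrelevant value 0 if Y is
   not a stable integral. *)
Definition stable_qnorm (R : realType) (d : measure_display)
    (T : measurableType d) (P : probability T R)
    (I : (R -> R) -> {RV P >-> R}) (alpha : R) (Y : T -> R) : \bar R :=
  xget 0%E [set N : \bar R | exists f : R -> R,
    [/\ Lalpha alpha f, {ae P, forall w, Y w = I f w} &
        N = 'N[lebesgue_measure]_(alpha%:E)[EFin \o f]%E]].

(* Main.v *)
Require Import Defs.
From HB Require Import structures.
From mathcomp Require Import all_boot all_order all_algebra.
From mathcomp Require Import all_classical all_reals all_analysis.
From mathcomp Require Import measurable_realfun ring lra.
Import Order.TTheory GRing.Theory Num.Theory.
Import numFieldNormedType.Exports.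

Local Open Scope classical_set_scope.
Local Open Scope ring_scope.

(** The increment integrand f = G_t - G_s is bounded below on two disjoint
    sets.  On (s, t) only e^(-lambda(t-x)) (t-x)^(H_t - 1/alpha) survives, which
    gives |t - s|^H_t by scaling.  On (0, s), put u = s - x and d = t - s: there
    f is a difference of exponentials of
    - lambda (u+d) + g1 ln(u+d) and - lambda u + g2 ln u, so |f| is at least a
    constant times |g u|, with g the difference of the two exponents.  Since
    u (u+d) g'(u) = (g1-g2) u - g2 d is affine with slope g1-g2 = H_t - H_s, it
    is of size |H_t - H_s| away from its only zero; hence g is steep on a
    subinterval of fixed length, and of size |H_t - H_s| on a part of it,
    uniformly in d. *)

(** * Membership in [Lalpha] and lower bounds for the quasi norm *)

Lemma Lalpha_finiteP (R : realType) (alpha : R) (f : R -> R) : 0 < alpha ->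
  Lalpha alpha f <-> measurable_fun [set: R] f /\
    (\int[lebesgue_measure]_x (`|f x| `^ alpha)%:E < +oo)%E.
Proof.
move=> a0.
have e : (\int[lebesgue_measure]_x (`|f x| `^ alpha)%:E =
    'N[lebesgue_measure]_(alpha%:E)[EFin \o f] `^ alpha)%E.
  by rewrite poweR_Lnorm ?gt_eqF.
rewrite e /Lalpha; split.
  move=> Lf; split.
    have : f \in mfun by exact: sub_Lfun_mfun Lf.
    by rewrite inE.
  have : f \in finLfun lebesgue_measure alpha%:E by exact: sub_Lfun_finLfun Lf.
  by rewrite inE /= /finite_norm => h; exact: poweR_lty.
move=> [mf fin]; rewrite inE; apply/andP; split; rewrite inE //=.
rewrite /finite_norm ltey; apply/eqP => Noo.
by move: fin; rewrite Noo poweRyr ?gt_eqF.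
Qed.

Lemma measurable_norm_powR (R : realType) (alpha : R) (f : R -> R) :
  measurable_fun [set: R] f ->
  measurable_fun [set: R] (EFin \o (fun x => `|f x| `^ alpha)).
Proof.
move=> mf; apply/measurable_EFinP.
apply: (@measurableT_comp _ _ _ _ _ _ (@powR R ^~ alpha)) => //.
exact: measurableT_comp.
Qed.

(** Minkowski's inequality fails for [alpha < 1]. Instead |f - g| is at most twice the larger of |f|
    and |g|, which gives |f - g|^alpha <= 2^alpha (|f|^alpha + |g|^alpha) for every positive
    [alpha]. *)
Lemma LalphaB (R : realType) (alpha : R) (f g : R -> R) : 0 < alpha ->
  Lalpha alpha f -> Lalpha alpha g -> Lalpha alpha (fun x => f x - g x).
Proof.
move=> a0 /(Lalpha_finiteP _ _ _ a0)[mf ff] /(Lalpha_finiteP _ _ _ a0)[mg fg].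
have nf := measurable_norm_powR _ alpha _ mf.
have ng := measurable_norm_powR _ alpha _ mg.
apply/(Lalpha_finiteP _ _ _ a0); split; first exact: measurable_funB.
have le2 x : `|f x - g x| `^ alpha <=
    2 `^ alpha * (`|f x| `^ alpha + `|g x| `^ alpha).
  rewrite mulrDr -!powRM//.
  have [fg0|/ltW gf0] := leP `|f x| `|g x|.
    apply: (@le_trans _ _ ((2 * `|g x|) `^ alpha)); last first.
      by rewrite lerDr powR_ge0.
    apply: ge0_ler_powR; rewrite ?nnegrE ?(ltW a0) ?mulr_ge0//.
    by rewrite (le_trans (ler_normB _ _))//; lra.
  apply: (@le_trans _ _ ((2 * `|f x|) `^ alpha)); last first.
    by rewrite lerDl powR_ge0.
  apply: ge0_ler_powR; rewrite ?nnegrE ?(ltW a0) ?mulr_ge0//.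
  by rewrite (le_trans (ler_normB _ _))//; lra.
apply: (@le_lt_trans _ _ (\int[lebesgue_measure]_x
    ((2 `^ alpha)%:E * ((`|f x| `^ alpha)%:E + (`|g x| `^ alpha)%:E)))%E).
  apply: ge0_le_integral => //.
  - by apply: measurable_norm_powR; exact: measurable_funB.
  - by apply: measurable_funeM; exact: emeasurable_funD.
  - by move=> x _; rewrite -EFinD -EFinM lee_fin.
rewrite ge0_integralZl//; [|exact: emeasurable_funD
  |by move=> x _; rewrite adde_ge0// lee_fin powR_ge0].
rewrite ge0_integralD//; try by move=> x _; rewrite lee_fin powR_ge0.
by apply: lte_mul_pinfty; rewrite ?lee_fin ?powR_ge0// lte_add_pinfty.
Qed.

(** Chebyshev's argument: restrict the integral to one interval. Both lower bounds of the theorem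
    are read off from it. *)
Lemma le_Lnorm_itv (R : realType) (alpha m p q : R) (f : R -> R) :
  0 < alpha -> 0 <= m -> p <= q -> measurable_fun [set: R] f ->
  (forall x, p < x < q -> m <= `|f x|) ->
  ((m * (q - p) `^ alpha^-1)%:E <=
     'N[lebesgue_measure]_(alpha%:E)[EFin \o f])%E.
Proof.
move=> a0 m0 pq mf mle.
have nf := measurable_norm_powR _ alpha _ mf.
have -> : (m * (q - p) `^ alpha^-1)%:E = ((m `^ alpha * (q - p))%:E `^ alpha^-1)%E.
  rewrite poweR_EFin powRM ?powR_ge0 ?subr_ge0//.
  by rewrite -powRrM mulfV ?gt_eqF// powRr1.
rewrite unlock; apply: gt0_ler_poweR.
- by rewrite invr_ge0 ltW.
- by rewrite in_itv /= lee_fin mulr_ge0 ?powR_ge0 ?subr_ge0 ?leey.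
- by rewrite in_itv /= leey andbT integral_ge0// => x _; exact: poweR_ge0.
rewrite (_ : (m `^ alpha * (q - p))%:E =
    \int[lebesgue_measure]_(x in `]p, q[) (m `^ alpha)%:E)%E; last first.
  rewrite integral_cst//= lebesgue_measure_itv/= lte_fin.
  by case: ltP => [//|qp]; rewrite (_ : q = p) ?subrr ?mulr0 ?mule0//; lra.
apply: (@le_trans _ _ (\int[lebesgue_measure]_(x in `]p, q[)
    (`|f x| `^ alpha)%:E)%E).
  apply: ge0_le_integral => //.
  - by move=> x _; rewrite lee_fin powR_ge0.
  - by apply: measurable_funTS.
  - move=> x /=; rewrite in_itv /= => /mle h; rewrite lee_fin.
    by apply: ge0_ler_powR; rewrite ?nnegrE ?(ltW a0).
by apply: ge0_subset_integral => // x _; rewrite lee_fin powR_ge0.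
Qed.

(** * Integrability of the kernel *)

Lemma is_derive_powR_ratio (R : realType) (r c x : R) : x < c ->
  is_derive x 1 (fun y => (1 + (c - y) `^ r)^-1)
    (r * (c - x) `^ (r - 1) / (1 + (c - x) `^ r) ^+ 2).
Proof.
move=> xc; have cx : 0 < c - x by rewrite subr_gt0.
have d1 : is_derive x 1 (fun y : R => c - y) (-1).
  by apply: is_derive_eq; rewrite add0r mul1r.
have d2 := @is_derive1_comp _ (@powR R ^~ r) (fun y => c - y) x _ _ (is_derive1_powR r cx) d1.
have nz : 1 + (c - x) `^ r != 0.
  by rewrite gt_eqF// ltr_pwDl// powR_ge0.
have d3 : is_derive x 1 (fun y : R => 1 + (c - y) `^ r)
    (r * (c - x) `^ (r - 1) * -1).
  rewrite -[X in is_derive _ _ _ X]add0r.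
  exact: (is_deriveD (is_derive_cst (1 : R) x 1) d2).
have d4 := is_deriveV (f := fun y => 1 + (c - y) `^ r) nz d3.
refine (is_derive_eq d4 _).
rewrite /GRing.scale/=; field.
by [].
Qed.

(** With u = c - x, the integrand is of order u^(r-1) near 0 and u^(-r-1) at infinity. It serves as
    an integrable majorant with an explicit primitive, (1 + u^r)^-1, whose values lie in [0, 1];
    hence the bound 1 for every interval. *)
Lemma integral_powR_ratio_le1 (R : realType) (r c p q : R) : 0 < r ->
  p < q -> q < c ->
  (\int[lebesgue_measure]_(x in `[p, q])
     (r * (c - x) `^ (r - 1) / (1 + (c - x) `^ r) ^+ 2)%:E <= 1%:E)%E.
Proof.
move=> r0 pq qc.
pose F := fun y : R => (1 + (c - y) `^ r)^-1.
have dF x : x < c -> is_derive x 1 F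
    (r * (c - x) `^ (r - 1) / (1 + (c - x) `^ r) ^+ 2).
  exact: is_derive_powR_ratio.
have pc := lt_trans pq qc.
have cF x : x < c -> {for x, continuous F}.
  move=> xc; apply: differentiable_continuous; apply/derivable1_diffP.
  exact: (@ex_derive _ _ _ _ _ _ _ (dF _ xc)).
have dpow s x : x < c -> derivable (fun x : R => (c - x) `^ s) x 1.
  move=> xc; have cx : 0 < c - x by rewrite subr_gt0.
  have d1 : is_derive x 1 (fun y : R => c - y) (-1).
    by apply: is_derive_eq; rewrite add0r mul1r.
  have d2 := @is_derive1_comp _ (@powR R ^~ s) (fun y => c - y) x _ _ (is_derive1_powR s cx) d1.
  exact: (@ex_derive _ _ _ _ _ _ _ d2).
rewrite (@continuous_FTC2 _ _ F)//.
- rewrite -EFinB lee_fin lerBlDr.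
  have F1 : F q <= 1 by rewrite /F invf_le1 ?ltr_pwDl ?powR_ge0// lerDl powR_ge0.
  have F0 : 0 <= F p by rewrite /F invr_ge0 addr_ge0// powR_ge0.
  by rewrite (le_trans F1)// lerDl.
- have -> : (fun x => r * (c - x) `^ (r - 1) / (1 + (c - x) `^ r) ^+ 2) =
      (cst r * (fun x => (c - x) `^ (r - 1))) * (F * F).
    by apply/funext => x; rewrite /= expr2 invfM.
  apply: derivable_within_continuous => x; rewrite in_itv/= => /andP[_ xq].
  have xc := le_lt_trans xq qc.
  have dFx := @ex_derive _ _ _ _ _ _ _ (dF _ xc).
  have dr := derivableM (derivable_cst r x 1) (dpow (r - 1) _ xc).
  exact: (derivableM dr (derivableM dFx dFx)).
- split.
  + move=> x; rewrite in_itv/= => /andP[_ xq].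
    exact: (@ex_derive _ _ _ _ _ _ _ (dF _ (lt_trans xq qc))).
  + by apply: cvg_at_right_filter; exact: cF.
  + by apply: cvg_at_left_filter; exact: cF.
- move=> x; rewrite in_itv/= => /andP[_ xq]; rewrite derive1E.
  exact: (@derive_val _ _ _ _ _ _ _ (dF _ (lt_trans xq qc))).
Qed.

Definition tempered_power (R : realType) (g lambda u : R) : R :=
  expR (- lambda * Num.max u 0) * pos_part_pow u g.

Lemma ltm_kernelE (R : realType) (h alpha lambda t x : R) :
  ltm_kernel h alpha lambda t x = tempered_power R (h - alpha^-1) lambda (t - x)
    - tempered_power R (h - alpha^-1) lambda (0 - x).
Proof. by rewrite /tempered_power sub0r. Qed.

Lemma tempered_power_ge0 (R : realType) (g lambda u : R) :
  0 <= tempered_power R g lambda u.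
Proof.
rewrite mulr_ge0 ?expR_ge0// /pos_part_pow.
by case: ifP => // _; exact: powR_ge0.
Qed.

Lemma tempered_power_le0 (R : realType) (g lambda u : R) :
  u <= 0 -> tempered_power R g lambda u = 0.
Proof. by move=> u0; rewrite /tempered_power /pos_part_pow ltNge u0 mulr0. Qed.

Lemma tempered_power_gt0 (R : realType) (g lambda u : R) :
  0 < u -> tempered_power R g lambda u = expR (- lambda * u + g * ln u).
Proof.
move=> u0; rewrite /tempered_power /pos_part_pow u0 max_l ?ltW//.
by rewrite /powR gt_eqF// expRD.
Qed.

Lemma measurable_tempered_power (R : realType) (g lambda c : R) :
  measurable_fun [set: R] (fun x => tempered_power R g lambda (c - x)).
Proof.
have mc : measurable_fun [set: R] (fun x : R => c - x) by exact: measurable_funB.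
apply: measurable_funM.
  apply: measurableT_comp => //; apply: measurable_funM => //.
  exact: measurable_maxr.
apply: measurable_fun_ifT => //.
  exact: measurable_fun_ltr.
exact: (@measurableT_comp _ _ _ _ _ _ (@powR R ^~ g)).
Qed.

(** Since r <= 2, 1 + u^r <= 2 (1 + u)^2, so the square is at most 4 (1 + u)^4. The exponential
    absorbs this fourth power through e^(ku) >= (1 + ku/4)^4. *)
Lemma expR_mul_powR_bound (R : realType) (k r u : R) : 0 < k -> 0 < r <= 2 ->
  0 < u -> expR (- k * u) * (1 + u `^ r) ^+ 2 <= 4 * (1 + 4 / k) ^+ 4.
Proof.
move=> k0 /andP[r0 r2] u0; rewrite mulNr expRN mulrC ler_pdivrMr ?expR_gt0//.
have ur : 1 + u `^ r <= 2 * (1 + u) ^+ 2.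
  have : u `^ r <= (1 + u) `^ 2%:R.
    apply: (@le_trans _ _ ((1 + u) `^ r)).
      by apply: ge0_ler_powR; rewrite ?nnegrE; lra.
    by apply: ler_powR => //; lra.
  by rewrite powR_mulrn; [nra|lra].
have uk : 1 + u <= (1 + 4 / k) * (1 + k * u / 4).
  have -> : (1 + 4 / k) * (1 + k * u / 4) = 1 + u + 4 / k + k * u / 4.
    by field; rewrite gt_eqF.
  have := divr_ge0 (ler0n R 4) (ltW k0); have := mulr_gt0 k0 u0; lra.
have e4 : (1 + k * u / 4) ^+ 4 <= expR (k * u).
  rewrite [leRHS](_ : _ = expR (k * u / 4) ^+ 4); last first.
    by rewrite -expRM_natl; congr expR; field.
  apply: lerXn2r; rewrite ?nnegrE ?expR_ge0 ?expR_ge1Dx//.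
  by have := mulr_gt0 k0 u0; lra.
apply: (@le_trans _ _ ((2 * (1 + u) ^+ 2) ^+ 2)).
  apply: lerXn2r; rewrite ?nnegrE//; first by rewrite addr_ge0// powR_ge0.
  by rewrite mulr_ge0// sqr_ge0.
rewrite (_ : (2 * (1 + u) ^+ 2) ^+ 2 = 4 * (1 + u) ^+ 4); last by ring.
rewrite -mulrA ler_pM2l//.
apply: (@le_trans _ _ (((1 + 4 / k) * (1 + k * u / 4)) ^+ 4)).
  by apply: lerXn2r; rewrite ?nnegrE//; lra.
rewrite exprMn ler_pM2l// exprn_gt0//.
by have := divr_ge0 (ler0n R 4) (ltW k0); lra.
Qed.

(** The power of u on the left is u^(g alpha) = u^(r-1), as in the majorant; the exponential pays
    for the denominator (1 + u^r)^2. *)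
Lemma le_tempered_power (R : realType) (alpha g lambda r u : R) : 0 < alpha ->
  0 < lambda -> r = g * alpha + 1 -> 0 < r <= 2 -> 0 < u ->
  tempered_power R g lambda u `^ alpha <=
  4 * (1 + 4 / (lambda * alpha)) ^+ 4 / r *
    (r * u `^ (r - 1) / (1 + u `^ r) ^+ 2).
Proof.
move=> a0 l0 re r02 u0; have := r02 => /andP[r0 r2].
have nz : 0 < 1 + u `^ r by rewrite ltr_pwDl// powR_ge0.
have -> : tempered_power R g lambda u `^ alpha =
    expR (- (lambda * alpha) * u) * u `^ (r - 1).
  rewrite tempered_power_gt0// -expRM mulrDl expRD; congr (_ * _).
    by congr expR; ring.
  by rewrite /powR gt_eqF//; congr expR; rewrite re; ring.
have := @expR_mul_powR_bound _ (lambda * alpha) r u (mulr_gt0 l0 a0) r02 u0.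
set C := 4 * _; rewrite -ler_pdivlMr ?exprn_gt0// => h.
rewrite [leRHS](_ : _ = C / (1 + u `^ r) ^+ 2 * u `^ (r - 1)).
  by rewrite ler_wpM2r// powR_ge0.
by field; rewrite !gt_eqF.
Qed.

(** Monotone convergence along compact intervals exhausting the half-line below [c]. The fundamental
    theorem of calculus is applied only on such intervals, away from the possible singularity at
    [c]. *)
Lemma integral_lty_lt (R : realType) (h : R -> R) (c M : R) :
  measurable_fun [set: R] h -> (forall x, 0 <= h x) ->
  (forall x, c <= x -> h x = 0) ->
  (forall p q, p < q -> q < c ->
    (\int[lebesgue_measure]_(x in `[p, q]) (h x)%:E <= M%:E)%E) ->
  (\int[lebesgue_measure]_x (h x)%:E < +oo)%E.
Proof.
move=> mh h0 hc hM.
(* The index starts at 2 because c - N < c - 1/N needs N > 1. *)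
pose F n : set R := `[c - n.+2%:R, c - n.+2%:R^-1]%classic.
have FU : \bigcup_n F n = [set x | x < c].
  apply/seteqP; split => x /=.
    move=> [n _]; rewrite /F /= in_itv/= => /andP[_].
    by move=> /le_lt_trans; apply; rewrite ltrBlDr ltrDl invr_gt0 ltr0n.
  move=> xc; have u0 : 0 < c - x by rewrite subr_gt0.
  have v0 : 0 < (c - x)^-1 by rewrite invr_gt0.
  (* An N above both c - x and its inverse puts x between the two endpoints. *)
  exists (Num.bound (c - x + (c - x)^-1)) => //.
  have b : c - x + (c - x)^-1 < (Num.bound (c - x + (c - x)^-1)).+2%:R.
    apply: (lt_trans (archi_boundP _)); first by rewrite addr_ge0// ltW.
    by rewrite ltr_nat ltnS leqnSn.
  rewrite /F /= in_itv/=; move: b; move: (_.+2%:R) => N b.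
  have xN : N^-1 <= c - x.
    by rewrite -[leRHS]invrK lef_pV2 ?posrE//; lra.
  by apply/andP; split; lra.
have -> : (\int[lebesgue_measure]_x (h x)%:E =
           \int[lebesgue_measure]_(x in \bigcup_n F n) (h x)%:E)%E.
  rewrite FU [RHS]integral_mkcond; apply: eq_integral => x _.
  rewrite patchE; case: ifPn => //; rewrite notin_setE /= => /negP.
  by rewrite -leNgt => /hc ->.
have cv : (\int[lebesgue_measure]_(x in F n) (h x)%:E @[n --> \oo] -->
    \int[lebesgue_measure]_(x in \bigcup_n F n) (h x)%:E)%E.
  apply: ge0_nondecreasing_set_cvg_integral => //.
  - apply/nondecreasing_seqP => n; apply/subsetPset => x.
    rewrite /F /= !in_itv/= => /andP[x1 x2].
    have n1 : n.+2%:R <= n.+3%:R :> R by rewrite ler_nat.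
    have n2 : n.+3%:R^-1 <= n.+2%:R^-1 :> R by rewrite lef_pV2 ?posrE.
    move: n1 n2 x1 x2; move: (n.+2%:R) (n.+3%:R) => N1 N2 n1 n2 x1 x2.
    by apply/andP; split; lra.
  - by move=> n; exact: measurable_itv.
  - by move=> n; apply: measurable_funTS; exact/measurable_EFinP.
  - by move=> n x _; rewrite lee_fin.
apply: (@le_lt_trans _ _ M%:E); last exact: ltry.
rewrite -(cvg_lim _ cv)//; apply: lime_le; first by apply/cvg_ex; eexists; exact: cv.
apply: nearW => n; apply: hM.
  have : (1 : R) <= n.+2%:R by rewrite ler1n.
  have : (n.+2%:R)^-1 < 1 :> R by rewrite invf_lt1 ?ltr1n.
  by move: (n.+2%:R) => N n1 n2; lra.
by rewrite ltrBlDr ltrDl invr_gt0 ltr0n.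
Qed.

Lemma Lalpha_tempered_power (R : realType) (alpha g lambda c : R) :
  0 < alpha -> 0 < lambda -> 0 < g * alpha + 1 <= 2 ->
  Lalpha alpha (fun x => tempered_power R g lambda (c - x)).
Proof.
move=> a0 l0 r02; apply/(Lalpha_finiteP _ _ _ a0).
have mt := measurable_tempered_power R g lambda c.
split; first exact: mt.
pose r := g * alpha + 1; pose C := 4 * (1 + 4 / (lambda * alpha)) ^+ 4 / r.
have /andP[r0 r2] := r02.
have C0 : 0 <= C.
  rewrite divr_ge0 ?(ltW r0)// mulr_ge0// exprn_ge0// addr_ge0// divr_ge0//.
  by rewrite mulr_ge0 ?ltW.
pose w x := r * (c - x) `^ (r - 1) / (1 + (c - x) `^ r) ^+ 2.
have w0 x : 0 <= w x.
  by rewrite !mulr_ge0 ?invr_ge0 ?sqr_ge0 ?powR_ge0// ltW.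
have mw : measurable_fun [set: R] (fun x => (w x)%:E : \bar R).
  have mc : measurable_fun [set: R] (fun x : R => c - x).
    exact: measurable_funB.
  have mp s : measurable_fun [set: R] (fun x : R => (c - x) `^ s).
    exact: (@measurableT_comp _ _ _ _ _ _ (@powR R ^~ s)).
  apply/measurable_EFinP; apply: measurable_funM.
    by apply: measurable_funM.
  (* The inverse is written as the power -1, so that measurability of [powR] applies. *)
  rewrite [f in measurable_fun _ f](_ : _ =
      @powR R ^~ (-1) \o (fun x => (1 + (c - x) `^ r) ^+ 2)); last first.
    by apply/funext => x /=; rewrite powR_inv1// sqr_ge0.
  apply: (@measurableT_comp _ _ _ _ _ _ (@powR R ^~ (-1))) => //.
  apply: measurable_funX => //.
  exact: (@measurable_funD _ _ _ _ (cst 1)).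
apply: (@integral_lty_lt _ (fun x => `|tempered_power R g lambda (c - x)| `^ alpha) c C).
- by apply/measurable_EFinP; exact: measurable_norm_powR.
- by move=> x; exact: powR_ge0.
- move=> x cx; rewrite tempered_power_le0 ?subr_le0// normr0 powR0//.
  by rewrite gt_eqF.
move=> p q pq qc.
apply: (@le_trans _ _
  (\int[lebesgue_measure]_(x in `[p, q]) (C%:E * (w x)%:E))%E).
  apply: ge0_le_integral => //.
  - by apply: measurable_funTS; exact: measurable_norm_powR.
  - by apply: measurable_funTS; exact: measurable_funeM.
  - move=> x /=; rewrite in_itv/= => /andP[_ xq]; rewrite -EFinM lee_fin.
    rewrite ger0_norm ?tempered_power_ge0//.
    by apply: le_tempered_power => //; lra.
rewrite ge0_integralZl//; [|exact: measurable_funTS|].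
  rewrite -[leRHS]mule1; apply: lee_wpmul2l; first by rewrite lee_fin.
  exact: integral_powR_ratio_le1.
by move=> x _; rewrite lee_fin.
Qed.

Lemma Lalpha_ltm_kernel (R : realType) (alpha h lambda t : R) :
  0 < alpha -> alpha <= 1 -> 0 < lambda -> 0 < h <= 2 ->
  Lalpha alpha (ltm_kernel h alpha lambda t).
Proof.
move=> a0 a1 l0 /andP[h0 h2].
(* This quantity equals h alpha, so h <= 2 and alpha <= 1 bound it by 2. *)
have r02 : 0 < (h - alpha^-1) * alpha + 1 <= 2.
  rewrite mulrBl mulVf ?gt_eqF// subrK mulr_gt0//=; nra.
rewrite (_ : ltm_kernel h alpha lambda t = fun x =>
    tempered_power R (h - alpha^-1) lambda (t - x) -
    tempered_power R (h - alpha^-1) lambda (0 - x)).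
  by apply: LalphaB => //; exact: Lalpha_tempered_power.
by apply/funext => x; exact: ltm_kernelE.
Qed.

(** * From the stable integral to the quasi norm of its integrand *)

Lemma Lalpha_integral_fin_num (R : realType) (alpha : R) (f : R -> R) :
  0 < alpha -> Lalpha alpha f ->
  (\int[lebesgue_measure]_x (`|f x| `^ alpha)%:E)%E \is a fin_num.
Proof.
move=> a0 /(Lalpha_finiteP _ _ _ a0)[_ fin].
by rewrite ge0_fin_numE// integral_ge0// => x _; rewrite lee_fin powR_ge0.
Qed.

(* The characteristic function of a stable integral determines the quasi norm
   of its integrand. *)
Lemma stable_integral_Lnorm_inj (R : realType) (d : measure_display)
    (T : measurableType d) (P : probability T R) (alpha : R)
    (I : (R -> R) -> {RV P >-> R}) (f g : R -> R) :
  0 < alpha -> stable_integral alpha I -> Lalpha alpha f -> Lalpha alpha g ->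
  {ae P, forall w, I f w = I g w} ->
  ('N[lebesgue_measure]_(alpha%:E)[EFin \o f] =
   'N[lebesgue_measure]_(alpha%:E)[EFin \o g])%E.
Proof.
move=> a0 hI Lf Lg fg.
have : ('E_P[fun w => cos (I f w)] = 'E_P[fun w => cos (I g w)])%E.
  rewrite unlock; apply: ae_eq_integral => //.
  - apply/measurable_EFinP; apply: measurableT_comp => //.
    exact: (continuous_measurable_fun (@continuous_cos R)).
  - apply/measurable_EFinP; apply: measurableT_comp => //.
    exact: (continuous_measurable_fun (@continuous_cos R)).
  - by apply: filterS fg => w fgw _; rewrite fgw.
rewrite (stable_integral_cos hI Lf) (stable_integral_cos hI Lg).
move=> /eqP; rewrite eqe => /eqP /expR_inj /oppr_inj efg.
rewrite unlock; congr (_ `^ _)%E.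
(* [Rintegral] is the [fine] part of the integral, which sends an infinite value to 0; equality of
   the real numbers lifts because both integrals are finite. *)
rewrite -[LHS]fineK; last exact: Lalpha_integral_fin_num Lf.
rewrite -[RHS]fineK; last exact: Lalpha_integral_fin_num Lg.
by congr _%:E; exact: efg.
Qed.

Lemma stable_qnormE (R : realType) (d : measure_display)
    (T : measurableType d) (P : probability T R) (alpha : R)
    (I : (R -> R) -> {RV P >-> R}) (f : R -> R) (Y : T -> R) :
  0 < alpha -> stable_integral alpha I -> Lalpha alpha f ->
  {ae P, forall w, Y w = I f w} ->
  stable_qnorm I alpha Y =
    'N[lebesgue_measure]_(alpha%:E)[EFin \o f]%E.
Proof.
move=> a0 hI Lf Yf; rewrite /stable_qnorm.
(* The default value 0 is excluded because [f] is itself a candidate. The integrand [g] that is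
   chosen may differ from [f], but it represents the same variable and so has the same norm. *)
case: xgetP => [N _ [g [Lg Yg ->]]|/(_ _)]; last first.
  by move/(_ ('N[lebesgue_measure]_(alpha%:E)[EFin \o f])%E); case; exists f.
apply: (stable_integral_Lnorm_inj _ _ _ _ _ _ _ _ a0 hI Lg Lf).
by apply: filterS2 Yf Yg => w <- <-.
Qed.

(** This removes the probability space: what remains is a deterministic estimate on the kernels. *)
Lemma stable_qnorm_LTmFSM_increment (R : realType) (d : measure_display)
    (T : measurableType d) (P : probability T R) (alpha lambda : R)
    (I : (R -> R) -> {RV P >-> R}) (H : R -> R) (X : R -> {RV P >-> R})
    (t s : R) :
  0 < alpha -> alpha <= 1 -> 0 < lambda -> (forall t, 0 < H t <= 2) ->
  stable_integral alpha I -> is_LTmFSM I H alpha lambda X ->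
  stable_qnorm I alpha (fun w => X t w - X s w) =
    'N[lebesgue_measure]_(alpha%:E)[EFin \o
      (fun x => ltm_kernel (H t) alpha lambda t x -
                ltm_kernel (H s) alpha lambda s x)%R]%E.
Proof.
move=> a0 a1 l0 H02 hI hX.
have Lk u := Lalpha_ltm_kernel R alpha (H u) lambda u a0 a1 l0 (H02 u).
apply: stable_qnormE => //; first exact: LalphaB.
have := stable_integral_linear hI 1 (-1) (Lk t) (Lk s).
have -> : (fun x => 1 * ltm_kernel (H t) alpha lambda t x +
                    -1 * ltm_kernel (H s) alpha lambda s x) =
          (fun x => ltm_kernel (H t) alpha lambda t x -
                    ltm_kernel (H s) alpha lambda s x).
  by apply/funext => x; rewrite mul1r mulN1r.
move=> lin; have := hX s; have := hX t; move: lin.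
apply: filterS3 => w -> -> ->.
by rewrite mul1r mulN1r.
Qed.

(** * Logarithms of ratios of tempered powers, and differences of exponentials *)

(** The sign of the affine function at 5e selects one of the windows [e, 3e] and [7e, 9e]. Moving
    from 5e into the right one increases its absolute value without changing its sign, and every
    point there is at distance at least 2e from 5e. *)
Lemma affine_away_from_zero (R : realType) (e n k : R) : 0 < e ->
  exists s x0 : R, [/\ s = 1 \/ s = -1, e <= x0, x0 <= 7 * e &
    forall u, x0 <= u -> u <= x0 + 2 * e -> 2 * e * `|n| <= s * (n * u - k)].
Proof.
move=> e0; have [n0|n0] := leP 0 n; have [m0|m0] := leP 0 (n * (5 * e) - k).
- exists 1, (7 * e); split; [by left|lra|lra|].
  by move=> u u1 u2; rewrite ger0_norm//; nra.
- exists (-1), e; split; [by right|lra|lra|].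
  by move=> u u1 u2; rewrite ger0_norm//; nra.
- exists 1, e; split; [by left|lra|lra|].
  by move=> u u1 u2; rewrite ltr0_norm//; nra.
- exists (-1), (7 * e); split; [by right|lra|lra|].
  by move=> u u1 u2; rewrite ltr0_norm//; nra.
Qed.

(** The sign of [f] at the midpoint of the window decides: if it is nonnegative, the last quarter
    works, otherwise the first. Each quarter is at distance e/2 from the midpoint. *)
Lemma steep_away_from_zero (R : realType) (f : R -> R) (e m x0 : R) :
  0 < e -> 0 <= m ->
  (forall u v, x0 <= u -> u < v -> v <= x0 + 2 * e -> m * (v - u) <= f v - f u) ->
  exists x1, [/\ x0 <= x1, x1 + e / 2 <= x0 + 2 * e &
    forall u, x1 < u < x1 + e / 2 -> m * (e / 2) <= `|f u|].
Proof.
move=> e0 m0 fm; have [f0|f0] := leP 0 (f (x0 + e)).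
- exists (x0 + 3 / 2 * e); split; [lra|lra|] => u /andP[u1 u2].
  have := fm (x0 + e) u; rewrite ler_normr => h; apply/orP; left.
  have {}h : m * (u - (x0 + e)) <= f u - f (x0 + e) by apply: h; lra.
  by nra.
- exists x0; split; [lra|lra|] => u /andP[u1 u2].
  have := fm u (x0 + e); rewrite ler_normr => h; apply/orP; right.
  have {}h : m * (x0 + e - u) <= f (x0 + e) - f u by apply: h; lra.
  by nra.
Qed.

(** The logarithm of the ratio of the tempered power with exponent [g1] at u + d to the one with
    exponent [g2] at u, for u > 0 and d >= 0; the terms in lambda u cancel. *)
Definition log_ratio (R : realType) (lambda d g1 g2 u : R) : R :=
  - lambda * d + g1 * ln (u + d) - g2 * ln u.

Lemma log_ratio_MVT (R : realType) (lambda d g1 g2 u v : R) :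
  0 <= d -> 0 < u -> u < v ->
  exists2 x, u < x < v &
    log_ratio R lambda d g1 g2 v - log_ratio R lambda d g1 g2 u =
    ((g1 - g2) * x - g2 * d) / (x * (x + d)) * (v - u).
Proof.
move=> d0 u0 uv.
have df (x : R) : 0 < x -> is_derive x 1 (log_ratio R lambda d g1 g2)
    (((g1 - g2) * x - g2 * d) / (x * (x + d))).
  move=> x0; have xd : 0 < x + d by lra.
  have d1 : is_derive x 1 (fun y : R => y + d) 1.
    by apply: is_derive_eq; rewrite addr0.
  have d2 := @is_derive1_comp _ (@ln R) (fun y => y + d) x _ _
    (is_derive1_ln xd) d1.
  have d3 := is_derive1_ln x0.
  have d4 := is_deriveB (is_deriveD (is_derive_cst (- lambda * d) x 1)
    (is_deriveZ g1 d2)) (is_deriveZ g2 d3).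
  apply: (is_derive_eq d4); rewrite /GRing.scale/=; field.
  by rewrite !gt_eqF.
have df' (x : R) : x \in `]u, v[ -> is_derive x 1 (log_ratio R lambda d g1 g2)
    (((g1 - g2) * x - g2 * d) / (x * (x + d))).
  by rewrite in_itv/= => /andP[ux _]; apply: df; exact: lt_trans ux.
have [|x + ->] := MVT uv df'; last by rewrite in_itv/=; exists x.
apply: derivable_within_continuous => x; rewrite in_itv/= => /andP[ux _].
exact: (@ex_derive _ _ _ _ _ _ _ (df _ (lt_le_trans u0 ux))).
Qed.

Lemma log_ratio_away_from_zero (R : realType) (lambda e d g1 g2 : R) :
  0 < e -> 0 <= d -> d <= 1 ->
  exists x1, [/\ e <= x1, x1 + e / 2 <= 9 * e &
    forall u, x1 < u < x1 + e / 2 ->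
      e / (9 * (9 * e + 1)) * `|g1 - g2| <= `|log_ratio R lambda d g1 g2 u|].
Proof.
move=> e0 d0 d1.
have [s [x0 [s1 x0e x07 hx]]] := affine_away_from_zero _ _ (g1 - g2) (g2 * d) e0.
(* The slope: the numerator of the derivative is at least 2e |g1 - g2|, and the denominator x (x +
   d) is at most 9e (9e + 1), as x <= 9e and d <= 1. No dependence on [d] remains. *)
pose m := 2 / (9 * (9 * e + 1)) * `|g1 - g2|.
have m0 : 0 <= m by rewrite mulr_ge0// divr_ge0//; lra.
have [|x1 [x01 x1e hm]] := steep_away_from_zero R
    (fun u => s * log_ratio R lambda d g1 g2 u) e m x0 e0 m0.
  move=> u v u1 uv v1; have u0 : 0 < u by lra.
  have [x /andP[ux xv] eq] := log_ratio_MVT _ lambda d g1 g2 _ _ d0 u0 uv.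
  rewrite -mulrBr eq mulrA ler_wpM2r ?subr_ge0 ?(ltW uv)//.
  have x_gt0 : 0 < x by lra.
  have xd : 0 < x + d by lra.
  rewrite mulrA ler_pdivlMr ?mulr_gt0//.
  have hx' : 2 * e * `|g1 - g2| <= s * ((g1 - g2) * x - g2 * d).
    by apply: hx; lra.
  apply: le_trans hx'.
  rewrite /m (_ : 2 / _ * _ * _ = 2 * `|g1 - g2| * (x * (x + d) / (9 * (9 * e + 1)))).
    rewrite [leRHS]mulrAC ler_wpM2l ?mulr_ge0// ler_pdivrMr; last lra.
    by nra.
  by field; lra.
exists x1; split; [lra|lra|] => u /hm; rewrite normrM.
have -> : `|s| = 1 by case: s1 => ->; rewrite ?normrN normr1.
rewrite mul1r; apply: le_trans; rewrite le_eqVlt; apply/orP; left; apply/eqP.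
by rewrite /m; field; lra.
Qed.

(** On the half-line above [M] the exponential has slope at least e^M; the inequality 1 + x <= e^x
    replaces a mean value argument. *)
Lemma expR_dist_ge (R : realType) (A B M : R) : M <= A -> M <= B ->
  expR M * `|A - B| <= `|expR A - expR B|.
Proof.
move=> MA MB.
have h x y : M <= y -> expR M * (x - y) <= expR x - expR y \/ x < y.
  move=> My; have [xy|] := leP y x; last by right.
  left; apply: (@le_trans _ _ (expR y * (x - y))).
    by rewrite ler_wpM2r ?subr_ge0 ?ler_expR.
  have -> : expR x = expR y * expR (x - y) by rewrite -expRD subrKC.
  rewrite [leRHS](_ : _ = expR y * (expR (x - y) - 1)); last by ring.
  rewrite ler_wpM2l ?expR_ge0//.
  by have := expR_ge1Dx (x - y); lra.
have [AB|/ltW AB] := leP B A.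
  rewrite (ger0_norm (x := A - B)) ?subr_ge0// ger0_norm ?subr_ge0 ?ler_expR//.
  by case: (h A B MB) => //; lra.
rewrite distrC (distrC (expR A)) (ger0_norm (x := B - A)) ?subr_ge0//.
rewrite ger0_norm ?subr_ge0 ?ler_expR//.
by case: (h B A MA) => //; lra.
Qed.

(** The inequality ln v < v, used at v and at 1/v. *)
Lemma norm_ln_le (R : realType) (e N v : R) : 0 < e -> e <= v -> v <= N ->
  `|ln v| <= N + e^-1.
Proof.
move=> e0 ev vN; have v0 : 0 < v by lra.
have h1 : ln v < v by exact: ln_sublinear.
have h2 : - ln v < v^-1 by rewrite -lnV ?posrE// ln_sublinear// invr_gt0.
have h3 : v^-1 <= e^-1 by rewrite lef_pV2 ?posrE.
have h4 : 0 < e^-1 by rewrite invr_gt0.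
by rewrite ler_norml; apply/andP; split; lra.
Qed.

(** * Lower bounds for the norm of the kernel increment *)

Section kernel_increment.
Variables (R : realType) (alpha lambda : R).
Hypotheses (alpha_gt0 : 0 < alpha) (alpha_le1 : alpha <= 1).
Hypothesis lambda_gt0 : 0 < lambda.

Definition ltm_increment (h k t s x : R) : R :=
  ltm_kernel h alpha lambda t x - ltm_kernel k alpha lambda s x.

Lemma measurable_ltm_increment (h k t s : R) :
  measurable_fun [set: R] (ltm_increment h k t s).
Proof.
rewrite (_ : ltm_increment h k t s = fun x =>
    (tempered_power R (h - alpha^-1) lambda (t - x) -
     tempered_power R (h - alpha^-1) lambda (0 - x)) -
    (tempered_power R (k - alpha^-1) lambda (s - x) -
     tempered_power R (k - alpha^-1) lambda (0 - x))).
  by do !apply: measurable_funB; exact: measurable_tempered_power.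
by apply/funext => x; rewrite /ltm_increment !ltm_kernelE.
Qed.

Lemma ltm_increment_pos (h k t s x : R) : 0 < x ->
  ltm_increment h k t s x =
    tempered_power R (h - alpha^-1) lambda (t - x) -
    tempered_power R (k - alpha^-1) lambda (s - x).
Proof.
move=> x0; rewrite /ltm_increment !ltm_kernelE.
have x0' : 0 - x <= 0 by lra.
by rewrite !(tempered_power_le0 _ _ _ _ x0') !subr0.
Qed.

(** Only the half of (s, t) next to [s] is used: there (t - s)/(t - x) lies in [1, 2]. As g = h -
    1/alpha <= 1, its power g is at most 2, whatever the sign of g, so (t - x)^g >= (t - s)^g /
    2. *)
Lemma Lnorm_ltm_increment_ge_time (h k t s : R) :
  0 < h <= 2 -> 0 < s -> s <= t -> t <= s + 1 ->
  ((expR (- lambda) / 2 * 2^-1 `^ alpha^-1 * `|t - s| `^ h)%:E <=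
    'N[lebesgue_measure]_(alpha%:E)[EFin \o ltm_increment h k t s])%E.
Proof.
move=> /andP[h0 h2] s0; rewrite le_eqVlt => /predU1P[<- _|st ts].
  rewrite subrr normr0 powR0 ?gt_eqF// mulr0; exact: Lnorm_ge0.
have d0 : 0 < t - s by lra.
pose g := h - alpha^-1.
have g1 : g <= 1.
  have ia : 1 <= alpha^-1 by rewrite invf_ge1.
  by rewrite /g; lra.
have d20 : s <= s + (t - s) / 2 by lra.
have m0 : 0 <= expR (- lambda) * ((t - s) `^ g / 2).
  by rewrite !mulr_ge0 ?expR_ge0 ?powR_ge0.
have := le_Lnorm_itv R alpha _ _ _ _ alpha_gt0 m0 d20 (measurable_ltm_increment h k t s).
(* The height contributes (t - s)^g and the length (t - s)^(1/alpha); together they give (t -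
   s)^h. *)
rewrite (_ : expR (- lambda) * _ * _ =
    expR (- lambda) / 2 * 2^-1 `^ alpha^-1 * `|t - s| `^ h); last first.
  rewrite ger0_norm ?(ltW d0)// (_ : s + _ - s = 2^-1 * (t - s)); last by field.
  rewrite powRM ?(ltW d0)// -[in RHS](subrK alpha^-1 h) -/g.
  by rewrite [in RHS]powRD; [field|rewrite (gt_eqF d0) implybT].
apply => x /andP[sx xt].
rewrite ltm_increment_pos; last lra.
have u0 : 0 < t - x by lra.
rewrite (tempered_power_le0 R _ _ (s - x)); last lra.
rewrite subr0 ger0_norm ?tempered_power_ge0//.
rewrite /tempered_power /pos_part_pow u0 max_l ?(ltW u0)// -/g.
apply: ler_pM; rewrite ?expR_ge0 ?divr_ge0 ?powR_ge0//.
  have xs : t - x <= 1 by lra.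
  by rewrite ler_expR mulNr lerN2 ger_pMr.
rewrite ler_pdivrMr//.
have -> : t - s = (t - x) * ((t - s) / (t - x)) by field; lra.
have r1 : 1 <= (t - s) / (t - x) by rewrite ler_pdivlMr//; lra.
have r2 : (t - s) / (t - x) <= 2 by rewrite ler_pdivrMr//; lra.
rewrite powRM ?(ltW u0)//; last lra.
rewrite ler_wpM2l ?powR_ge0//.
by rewrite (le_trans (ler1_powR _ _))//.
Qed.

Lemma Lnorm_ltm_increment_ge_index (t0 : R) : 0 < t0 ->
  exists2 c : R, 0 < c & forall h k t s : R,
    0 < h <= 2 -> 0 < k <= 2 -> t0 <= s -> s <= t -> t <= s + 1 ->
    ((c * `|h - k|)%:E <=
      'N[lebesgue_measure]_(alpha%:E)[EFin \o ltm_increment h k t s])%E.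
Proof.
(* The window for u = s - x lies in [e, 9e], and 9e < 16e = t0 <= s. Hence x > 0, where the kernel
   terms at -x vanish. *)
move=> t00; pose e := t0 / 16; have e0 : 0 < e by rewrite divr_gt0.
(* Both s - x and t - x lie in [e, 9e + 1], because t - s <= 1. There [L] bounds the logarithm and
   [G] the exponents in absolute value, so [M] bounds both arguments of the exponentials from
   below. *)
pose L := 9 * e + 1 + e^-1; pose G := 2 + alpha^-1.
pose M := - (lambda * (9 * e + 1) + G * L).
pose K := e / (9 * (9 * e + 1)).
have ie0 : 0 < e^-1 by rewrite invr_gt0.
have ia0 : 0 < alpha^-1 by rewrite invr_gt0.
have K0 : 0 < K by rewrite divr_gt0//; lra.
exists (expR M * K * (e / 2) `^ alpha^-1).
  have e20 : 0 < e / 2 by lra.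
  by rewrite mulr_gt0 ?powR_gt0// mulr_gt0// expR_gt0.
move=> h k t s /andP[h0 h2] /andP[k0 k2] t0s st ts.
have d0 : 0 <= t - s by lra.
have d1 : t - s <= 1 by lra.
have [x1 [ex1 x19 hx]] := log_ratio_away_from_zero R lambda e (t - s)
  (h - alpha^-1) (k - alpha^-1) e0 d0 d1.
have pq : s - x1 - e / 2 <= s - x1 by lra.
have hk : h - alpha^-1 - (k - alpha^-1) = h - k by lra.
have m0 : 0 <= expR M * (K * `|h - k|).
  by rewrite mulr_ge0 ?expR_ge0// mulr_ge0// ltW.
have := le_Lnorm_itv R alpha _ _ _ _ alpha_gt0 m0 pq (measurable_ltm_increment h k t s).
rewrite (_ : expR M * _ * _ = expR M * K * (e / 2) `^ alpha^-1 * `|h - k|);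
  last first.
  by rewrite (_ : s - x1 - _ = e / 2); [ring|lra].
apply => x /andP[px xq].
have u_lo : x1 < s - x by lra.
have u_hi : s - x < x1 + e / 2 by lra.
have et : t0 = 16 * e by rewrite /e; field.
rewrite ltm_increment_pos; last lra.
rewrite !tempered_power_gt0; [|lra|lra].
have lower g v : `|g| <= G -> e <= v -> v <= 9 * e + 1 ->
    M <= - lambda * v + g * ln v.
  move=> gG ev vN; have lnv := norm_ln_le _ _ _ _ e0 ev vN.
  have : `|g * ln v| <= G * L by rewrite normrM ler_pM.
  have lv : lambda * v <= lambda * (9 * e + 1) by rewrite ler_pM2l.
  by rewrite ler_norml => /andP[+ _]; rewrite /M; lra.
have gG r : 0 < r -> r <= 2 -> `|r - alpha^-1| <= G.
  by move=> r0 r2; rewrite ler_norml /G; apply/andP; split; lra.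
apply: le_trans (expR_dist_ge _ _ _ M _ _).
- apply: ler_wpM2l; first exact: expR_ge0.
  rewrite -hk; apply: le_trans (hx (s - x) _) _; first by rewrite u_lo u_hi.
  rewrite /log_ratio (_ : s - x + (t - s) = t - x); last lra.
  rewrite le_eqVlt; apply/orP; left; apply/eqP; congr `|_|.
  by ring.
- by apply: lower; [exact: gG|lra|lra].
- by apply: lower; [exact: gG|lra|lra].
Qed.

End kernel_increment.

Theorem proposition18 (R : realType) (a b lambda t0 alpha : R)
    (ha : 0 < a) (hab : a <= b) (hb : b <= 2) (hlambda : 0 < lambda)
    (halpha0 : 0 < alpha) (halpha1 : alpha <= 1) (ht0 : 0 < t0) :
  exists2 c : R, 0 < c &
    forall (H : R -> R) (d : measure_display) (T : measurableType d)
      (P : probability T R) (I : (R -> R) -> {RV P >-> R})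
      (X : R -> {RV P >-> R}),
      continuous H ->
      (forall t, a <= H t <= b) ->
      stable_integral alpha I ->
      is_LTmFSM I H alpha lambda X ->
      forall t s : R, t0 <= s -> s <= t -> t <= s + 1 ->
        ((c * (`|t - s| `^ H t + `|H t - H s|))%R%:E
          <= stable_qnorm I alpha (fun w => (X t w - X s w)%R))%E.
Proof.
have b2 x : a <= x <= b -> 0 < x <= 2.
  by move=> /andP[ax xb]; apply/andP; split; lra.
have [c2 c20 index_ge] :=
  Lnorm_ltm_increment_ge_index R alpha lambda halpha0 hlambda t0 ht0.
pose c1 := expR (- lambda) / 2 * 2^-1 `^ alpha^-1.
have c10 : 0 < c1 by rewrite !mulr_gt0 ?expR_gt0 ?powR_gt0// invr_gt0.
(* The norm dominates both c1 A and c2 B, where A and B are the two terms on the left; hence it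
   dominates their mean, which is at least min(c1, c2) (A + B) / 2. *)
exists (Num.min c1 c2 / 2); first by rewrite divr_gt0// lt_min c10.
move=> H d T P I X _ Hab hI hX t s t0s st ts.
have H02 u : 0 < H u <= 2 by exact/b2/Hab.
rewrite (stable_qnorm_LTmFSM_increment _ _ _ _ _ lambda _ H)//.
have s0 : 0 < s by lra.
have N1 := Lnorm_ltm_increment_ge_time R alpha lambda halpha0 halpha1 hlambda
  (H t) (H s) t s (H02 t) s0 st ts.
have N2 := index_ge (H t) (H s) t s (H02 t) (H02 s) t0s st ts.
set A := `|t - s| `^ H t in N1 *; set B := `|H t - H s| in N2 *.
have A0 : 0 <= A by exact: powR_ge0.
have B0 : 0 <= B by exact: normr_ge0.
have m1 : Num.min c1 c2 <= c1 by rewrite ge_min lexx.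
have m2 : Num.min c1 c2 <= c2 by rewrite ge_min lexx orbT.
have [AB|/ltW AB] := leP (c2 * B) (c1 * A).
  by apply: le_trans N1; rewrite lee_fin -/c1; nra.
by apply: le_trans N2; rewrite lee_fin; nra.
Qed.
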